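(* Let $u=\log x$. The function $F^{(0)}(x)=\inf_{n\in\mathbb N}F_n^{(0)}(x)$ has the asymptotics $$F^{(0)}(x)=e\,u+\frac{e}{2}\,\frac{\langle u\rangle^2}{u}+O\!\left(\frac1{u^2}\right)\qquad\text{as }x\to\infty .$$
   Context: For $n\in\mathbb N=\{1,2,\dots\}$ and $x>0$, $$F^{(0)}_n(x)=\inf_{t_1,\dots,t_{n-1}>0}\left(t_1+\frac{t_2}{t_1}+\dots+\frac{t_{n-1}}{t_{n-2}}+\frac{x}{t_{n-1}}\right)$$ (with $F^{(0)}_1(x)=x$); equivalently, by the AM-GM inequality, $F^{(0)}_n(x)=n x^{1/n}$. For real $y$, $\langle y\rangle=\operatorname{dist}(y,\mathbb Z)$ is the distance from $y$ to the nearest integer. *)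

(* Defs.v *)
From HB Require Import structures.
From mathcomp Require Import all_boot all_order all_algebra.
From mathcomp Require Import all_classical all_reals all_analysis.

Set Implicit Arguments.
Unset Strict Implicit.
Unset Printing Implicit Defensive.

Import Order.TTheory GRing.Theory Num.Theory.
Import numFieldNormedType.Exports.

Local Open Scope classical_set_scope.
Local Open Scope ring_scope.

(* Lets the Landau notations be used at +oo. *)
Canonical pinfty_filter_on (R : numFieldType) :=
  FilterType (pinfty_nbhs R) (@proper_pinfty_nbhs R).

(* With t_0 := 1 and t_n := x this is \sum_(i < n) t_(i+1) / t_i, for the
   n - 1 free variables t_1, ..., t_(n-1); it equals x when n = 1. *)
Definition chain_sum (R : realType) (n : nat) (t : n.-1.-tuple R) (x : R) : R :=
  \sum_(i < n) (rcons t x)`_i / (1 :: t)`_i.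

(* Meaningful for n >= 1 and x > 0, where the set is nonempty and bounded below
   by 0; n is the number of summands. *)
Definition F0n (R : realType) (n : nat) (x : R) : R :=
  inf [set chain_sum t x | t in [set t : n.-1.-tuple R |
         forall i : 'I_n.-1, 0 < tnth t i]].

Definition F0 (R : realType) (x : R) : R :=
  inf [set F0n n x | n in [set n : nat | (0 < n)%N]].

Definition dist_int (R : realType) (y : R) : R :=
  inf [set `|y - m%:~R| | m in [set: int]].

(* Main.v *)
Require Import Defs.
From HB Require Import structures.
From mathcomp Require Import all_boot all_order all_algebra.
From mathcomp Require Import all_classical all_reals all_analysis.
From mathcomp Require Import ring lra.

(* By AM-GM, F_n(x) = n e^{u/n} with u = ln x. Put w = (u - n)/n > -1; then
   u = n (1 + w) and F_n(x) = e n e^w, so expanding e^w to second order gives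
   F_n(x) = e u + e (u - n)^2 / (2n) + error. Taking n to be the integer nearest
   to u gives the upper bound. For the lower bound one needs all n at once: for
   n <= u the quadratic bound on e^w suffices since 1/n >= 1/u, and for n > u
   the cubic one yields e u + (e u/2) ((n - u)/n)^2, where (n - u)/n increases
   with n. The constant in the O is e. *)

Set Implicit Arguments.
Unset Strict Implicit.

Import Order.TTheory GRing.Theory Num.Theory.
Import numFieldNormedType.Exports.

Local Open Scope classical_set_scope.
Local Open Scope ring_scope.

(** * Attained infima and the nearest integer *)

Lemma inf_attained (R : realType) (A : set R) (a : R) :
  A a -> lbound A a -> inf A = a.
Proof.
move=> Aa lba; apply/eqP; rewrite eq_le; apply/andP; split.
  by apply: ge_inf => //; exists a.
by apply: lb_le_inf => //; exists a.
Qed.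

Lemma dist_intP (R : realType) (y : R) :
  exists m : int, dist_int y = `|y - m%:~R| /\ `|y - m%:~R| <= 1 / 2.
Proof.
set m := Num.floor (y + 1 / 2); exists m.
have ym : `|y - m%:~R| <= 1 / 2.
  have /andP[] := floor_itv (y + 1 / 2); rewrite -/m intrD => h1 h2.
  by rewrite ler_norml; apply/andP; split; lra.
split=> //; apply: inf_attained; first by exists m.
move=> _ [k _ <-]; have [->//|km] := eqVneq k m.
(* Distinct integers are at least 1 apart, so [k] is at distance at least 1 - 1/2 from [y]. *)
have : 1 <= `|m%:~R - k%:~R| :> R.
  by rewrite -intrB -intr_norm ler1z -gtz0_ge1 normr_gt0 subr_eq0 eq_sym.
have := ler_distD y (m%:~R : R) k%:~R; rewrite (distrC m%:~R y) => h1 h2.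
lra.
Qed.

Lemma dist_int_le (R : realType) (y : R) (m : int) : dist_int y <= `|y - m%:~R|.
Proof.
apply: ge_inf; last by exists m.
by exists 0 => _ [k _ <-].
Qed.

(** * Taylor bounds for the exponential *)

(* Its derivative at w is e^{-w} w^2 (3c - 1/2 - c w), so its comparison with 1,
   i.e. a cubic Taylor bound on e^w, follows from monotonicity. *)
Definition exp_ratio (R : realType) (c w : R) : R :=
  expR (- w) * (1 + w + w ^+ 2 / 2 + c * w ^+ 3).

Lemma exp_ratio_derive (R : realType) (c w : R) :
  is_derive w 1 (exp_ratio c)
    (expR (- w) * (w ^+ 2 * (3 * c - 1 / 2 - c * w))).
Proof.
rewrite /exp_ratio; apply: is_derive_eq.
by rewrite /GRing.scale /=; field.
Qed.

Lemma exp_ratio_cont (R : realType) (c : R) (A : set R) :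
  {within A, continuous (exp_ratio c)}.
Proof.
apply: continuous_subspaceT => w; apply: differentiable_continuous.
by apply/derivable1_diffP; have [] := exp_ratio_derive c w.
Qed.

Lemma exp_ratio_ndecr (R : realType) (c a b : R) : a <= b ->
  (forall w, a <= w <= b -> 0 <= 3 * c - 1 / 2 - c * w) ->
  exp_ratio c a <= exp_ratio c b.
Proof.
move=> ab h; apply: (@ger0_derive1_le_cc R (exp_ratio c) a b);
  rewrite ?in_itv/= ?lexx ?ab//.
- move=> w; rewrite in_itv/= => /andP[aw wb].
  rewrite derive1E (@derive_val _ _ _ _ _ _ _ (exp_ratio_derive c w)).
  by rewrite pmulr_rge0 ?expR_gt0// mulr_ge0 ?sqr_ge0 ?h// !ltW.
- exact: exp_ratio_cont.
Qed.

Lemma exp_ratio_nincr (R : realType) (c a b : R) : a <= b ->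
  (forall w, a <= w <= b -> 3 * c - 1 / 2 - c * w <= 0) ->
  exp_ratio c b <= exp_ratio c a.
Proof.
move=> ab h; apply: (@ler0_derive1_le_cc R (exp_ratio c) a b);
  rewrite ?in_itv/= ?lexx ?ab//.
- move=> w; rewrite in_itv/= => /andP[aw wb].
  rewrite derive1E (@derive_val _ _ _ _ _ _ _ (exp_ratio_derive c w)).
  by rewrite pmulr_rle0 ?expR_gt0// mulr_ge0_le0 ?sqr_ge0 ?h// !ltW.
- exact: exp_ratio_cont.
Qed.

Lemma exp_ratio0 (R : realType) (c : R) : exp_ratio c 0 = 1.
Proof. by rewrite /exp_ratio oppr0 expR0; ring. Qed.

Lemma exp_ratio_le1 (R : realType) (c w : R) :
  (exp_ratio c w <= 1) = (1 + w + w ^+ 2 / 2 + c * w ^+ 3 <= expR w).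
Proof. by rewrite /exp_ratio mulrC expRN ler_pdivrMr ?expR_gt0// mul1r. Qed.

Lemma exp_ratio_ge1 (R : realType) (c w : R) :
  (1 <= exp_ratio c w) = (expR w <= 1 + w + w ^+ 2 / 2 + c * w ^+ 3).
Proof. by rewrite /exp_ratio mulrC expRN ler_pdivlMr ?expR_gt0// mul1r. Qed.

(** For c = 0 the derivative's factor 3c - 1/2 - c w is the constant -1/2, so [exp_ratio 0]
    decreases through the value 1 at 0. This yields both quadratic bounds, one on each side of 0. *)
Lemma expR_ge_quadratic (R : realType) (w : R) : 0 <= w ->
  1 + w + w ^+ 2 / 2 <= expR w.
Proof.
move=> w0; have := exp_ratio_le1 0 w; rewrite mul0r addr0 => <-.
by rewrite -(exp_ratio0 0); apply: exp_ratio_nincr => // v _; lra.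
Qed.

Lemma expR_le_quadratic (R : realType) (w : R) : w <= 0 ->
  expR w <= 1 + w + w ^+ 2 / 2.
Proof.
move=> w0; have := exp_ratio_ge1 0 w; rewrite mul0r addr0 => <-.
by rewrite -(exp_ratio0 0); apply: exp_ratio_nincr => // v _; lra.
Qed.

(** For c = 1/6 the factor 3c - 1/2 - c w is -w/6, nonnegative left of 0. *)
Lemma expR_ge_cubic (R : realType) (w : R) : w <= 0 ->
  1 + w + w ^+ 2 / 2 + 1 / 6 * w ^+ 3 <= expR w.
Proof.
move=> w0; rewrite -exp_ratio_le1 -[leRHS](exp_ratio0 (1 / 6)).
by apply: exp_ratio_ndecr => // v /andP[_ v0]; lra.
Qed.

(** The coefficient c = 1 is generous: the factor becomes 5/2 - w, positive on [0, 1]. Writing [1 *]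
    keeps the shape of [exp_ratio_ge1]. *)
Lemma expR_le_cubic (R : realType) (w : R) : 0 <= w <= 1 ->
  expR w <= 1 + w + w ^+ 2 / 2 + 1 * w ^+ 3.
Proof.
move=> /andP[w0 w1]; rewrite -exp_ratio_ge1 -[leLHS](exp_ratio0 1).
by apply: exp_ratio_ndecr => // v /andP[_ vw]; lra.
Qed.

(** * Closed form of F_n by AM-GM *)

(* AM-GM: if a is the geometric mean of the ratios r_i, then
   r_i / a >= 1 + ln (r_i / a), and the logarithms sum to 0. *)
Lemma chain_sum_ge (R : realType) (m : nat) (t : m.-tuple R) (x : R) : 0 < x ->
  (forall i, 0 < tnth t i) ->
  m.+1%:R * expR (ln x / m.+1%:R) <= @chain_sum R m.+1 t x.
Proof.
move=> x0 t0; set a := expR _; have a0 : 0 < a by exact: expR_gt0.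
(* With t_0 = 1 in front and x at the end, the logarithms of consecutive ratios telescope to ln
   x. *)
pose s : seq R := 1 :: rcons t x.
have spos i : (i <= m.+1)%N -> 0 < s`_i.
  move=> im; have : all (fun z => 0 < z) s.
    by rewrite /s /= ltr01 all_rcons x0 /=; apply/all_tnthP.
  by move=> /allP; apply; apply: mem_nth; rewrite /s /= size_rcons size_tuple.
have -> : @chain_sum R m.+1 t x = \sum_(0 <= i < m.+1) s`_i.+1 / s`_i.
  rewrite /chain_sum big_mkord; apply: eq_bigr => i _ /=.
  congr (_ / _); rewrite /s -rcons_cons nth_rcons /= size_tuple.
  by rewrite ltn_ord.
have -> : m.+1%:R * a =
    \sum_(0 <= i < m.+1) a * (1 + (ln s`_i.+1 - ln s`_i - ln a)).
  rewrite -mulr_sumr big_split /= sumrB telescope_sumr// !big_const_nat.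
  rewrite subn0 !iter_addr_0.
  rewrite /s /= nth_rcons size_tuple ltnn eqxx ln1 subr0 /a expRK.
  by rewrite -[X in _ - X]mulr_natr divfK ?pnatr_eq0// subrr addr0 mulrC.
rewrite !big_nat; apply: ler_sum => i /andP[_ im].
have p0 := spos i (ltnW im); have p1 := spos i.+1 im.
rewrite -ler_pdivlMl// (le_trans (expR_ge1Dx _))//.
by rewrite !expRB !lnK ?posrE// mulrC.
Qed.

(** Equality case of AM-GM: for t_i = a^i with a = x^(1/n), every ratio equals a. *)
Lemma F0nE (R : realType) (n : nat) (x : R) : (0 < n)%N -> 0 < x ->
  F0n n x = n%:R * expR (ln x / n%:R).
Proof.
case: n => // m _ x0; apply: inf_attained; last first.
  by move=> _ [t t0 <-]; exact: chain_sum_ge.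
set a := expR _; have a0 : 0 < a by exact: expR_gt0.
have aX : a ^+ m.+1 = x.
  by rewrite -expRM_natr divfK ?pnatr_eq0// lnK ?posrE.
pose t := [tuple a ^+ i.+1 | i < m].
have tE j : (j < m)%N -> t`_j = a ^+ j.+1.
  by move=> jm; rewrite (nth_mktuple _ 0 (Ordinal jm)).
exists t => /=; first by move=> i; rewrite tnth_mktuple exprn_gt0.
rewrite /chain_sum (eq_bigr (fun=> a));
  first by rewrite sumr_const card_ord mulr_natl.
move=> [j jm] _ /=.
(* At the last index j = m the entry is x, which is a^(m+1). *)
have -> : (rcons t x)`_j = a ^+ j.+1.
  rewrite nth_rcons size_tuple; move: jm.
  rewrite ltnS leq_eqVlt => /predU1P[->|jm].
    by rewrite ltnn eqxx.
  by rewrite jm tE.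
case: j jm => [|j] jm; first by rewrite /= divr1.
by rewrite [nth _ _ _]tE// exprS mulfK// expf_neq0// gt_eqF.
Qed.

Lemma F0_le (R : realType) (n : nat) (x : R) : (0 < n)%N -> 0 < x ->
  F0 x <= n%:R * expR (ln x / n%:R).
Proof.
move=> n0 x0; rewrite -F0nE//; apply: ge_inf; last by exists n.
by exists 0 => _ [k k0 <-]; rewrite F0nE// mulr_ge0// expR_ge0.
Qed.

Lemma F0_ge (R : realType) (x y : R) : 0 < x ->
  (forall n, (0 < n)%N -> y <= n%:R * expR (ln x / n%:R)) -> y <= F0 x.
Proof.
move=> x0 h; apply: lb_le_inf; first by exists (F0n 1 x), 1%N.
by move=> _ [n n0 <-]; rewrite F0nE//; exact: h.
Qed.

(** * Two-sided estimates of n e^((u-n)/n) *)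

Lemma expR_div_shift (R : realType) (u n : R) : n != 0 ->
  expR (u / n) = expR 1 * expR ((u - n) / n).
Proof. by move=> n0; rewrite -expRD; congr expR; field. Qed.

(** The parameter [d] is decoupled from [n] so that a single value, the distance from u to the
    integers, serves every n in the infimum. *)
Lemma scaled_exp_ge (R : realType) (u n d : R) : 0 < u -> 0 < n ->
  0 <= d <= 1 / 2 -> d <= `|u - n| ->
  u + d ^+ 2 / u / 2 - 1 / u ^+ 2 <= n * expR ((u - n) / n).
Proof.
move=> u0 n0 /andP[d0 d1] dun.
have [une nne] : u != 0 /\ n != 0 by rewrite !gt_eqF.
have iu0 : 0 <= 1 / u ^+ 2 by rewrite divr_ge0// sqr_ge0.
have [nu|un] := leP n u.
  have w0 : 0 <= (u - n) / n by rewrite divr_ge0 ?subr_ge0// ltW.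
  have := expR_ge_quadratic w0; rewrite -(ler_pM2l n0); apply: le_trans.
  have -> : n * (1 + (u - n) / n + ((u - n) / n) ^+ 2 / 2) =
    u + (u - n) ^+ 2 / n / 2 by field.
  have : d ^+ 2 / u <= (u - n) ^+ 2 / n.
    apply: ler_pM; rewrite ?sqr_ge0 ?invr_ge0 ?(ltW u0)// ?lef_pV2//.
    by rewrite ger0_norm ?subr_ge0// in dun; rewrite ler_sqr ?nnegrE ?subr_ge0.
  lra.
have w0 : (u - n) / n <= 0 by rewrite pmulr_lle0 ?invr_gt0// subr_le0 ltW.
have := expR_ge_cubic w0; rewrite -(ler_pM2l n0); apply: le_trans.
set r := (n - u) / n.
(* Here (u - n)/n = -r and n r = n - u, so the quadratic and cubic terms add up to r^2 (3n - n r)/6.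
   Since n > u, this is at least u r^2 / 2. *)
have -> : n * (1 + (u - n) / n + ((u - n) / n) ^+ 2 / 2 +
      1 / 6 * ((u - n) / n) ^+ 3) =
    u + r ^+ 2 * (2 * n + u) / 6 by rewrite /r; field.
have ud0 : 0 < u + d by lra.
(* r = 1 - u/n increases with n, and n >= u + d. *)
have dr : d / (u + d) <= r.
  have dnu : d <= n - u by move: dun; rewrite ltr0_norm ?subr_lt0// opprB.
  by rewrite /r ler_pdivrMr// mulrAC ler_pdivlMr//; nra.
have dr2 : (d / (u + d)) ^+ 2 <= r ^+ 2.
  have dd0 : 0 <= d / (u + d) by rewrite divr_ge0// ltW.
  by rewrite ler_sqr ?nnegrE// (le_trans dd0).
(* Replacing u + d by u in the denominator costs about 2 d^3 / u^2; halved at the end, the allowance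
   2/u^2 becomes the error 1/u^2. *)
have key : d ^+ 2 / u - 2 / u ^+ 2 <= u * (d / (u + d)) ^+ 2.
  rewrite -subr_ge0.
  have -> : u * (d / (u + d)) ^+ 2 - (d ^+ 2 / u - 2 / u ^+ 2) =
    (d ^+ 2 * (u ^+ 3 - u * (u + d) ^+ 2) + 2 * (u + d) ^+ 2) /
    (u ^+ 2 * (u + d) ^+ 2).
    by field; rewrite une gt_eqF.
  apply: divr_ge0; last by rewrite mulr_ge0 ?sqr_ge0.
  have -> : d ^+ 2 * (u ^+ 3 - u * (u + d) ^+ 2) + 2 * (u + d) ^+ 2 =
    2 * u ^+ 2 * (1 - d ^+ 3) + u * d * (4 - d ^+ 3) + 2 * d ^+ 2 by ring.
  have d3 : d ^+ 3 <= 1 by rewrite exprn_ile1//; lra.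
  by rewrite !addr_ge0 ?mulr_ge0 ?sqr_ge0//; lra.
have := ler_wpM2l (ltW u0) dr2.
have : 3 * u * r ^+ 2 <= (2 * n + u) * r ^+ 2.
  by apply: ler_wpM2r; [exact: sqr_ge0|lra].
lra.
Qed.

(** For n >= u the quadratic bound suffices, as 1/n <= 1/u. For n < u the excess of d^2/(2n) over
    d^2/(2u), with d = u - n, and the cubic term are both absorbed by 1/u^2. *)
Lemma scaled_exp_le (R : realType) (u n : R) : 1 <= u -> `|u - n| <= 1 / 2 ->
  n * expR ((u - n) / n) <= u + `|u - n| ^+ 2 / u / 2 + 1 / u ^+ 2.
Proof.
move=> u1 dn; rewrite real_normK ?num_real//.
(* n >= u - 1/2 >= u/2 because u >= 1. *)
have n2 : u / 2 <= n by move: dn; rewrite ler_norml => /andP[_]; lra.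
have [u0 n0] : 0 < u /\ 0 < n by split; lra.
have [une nne] : u != 0 /\ n != 0 by rewrite !gt_eqF.
have iu0 : 0 <= 1 / u ^+ 2 by rewrite divr_ge0// sqr_ge0.
have [un|nu] := leP u n.
  have w0 : (u - n) / n <= 0 by rewrite pmulr_lle0 ?invr_gt0// subr_le0.
  have := expR_le_quadratic w0; rewrite -(ler_pM2l n0) => /le_trans; apply.
  have -> : n * (1 + (u - n) / n + ((u - n) / n) ^+ 2 / 2) =
    u + (u - n) ^+ 2 / n / 2 by field.
  have : (u - n) ^+ 2 / n <= (u - n) ^+ 2 / u.
    by rewrite ler_wpM2l ?sqr_ge0// lef_pV2.
  lra.
rewrite gtr0_norm ?subr_gt0// in dn.
have w0 : 0 <= (u - n) / n <= 1.
  by rewrite ler_pdivrMr// divr_ge0//=; lra.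
have := expR_le_cubic w0; rewrite -(ler_pM2l n0) => /le_trans; apply.
set d := u - n in dn *; have d0 : 0 < d by rewrite subr_gt0.
rewrite -subr_ge0.
have -> : u + d ^+ 2 / u / 2 + 1 / u ^+ 2 -
    n * (1 + d / n + (d / n) ^+ 2 / 2 + 1 * (d / n) ^+ 3) =
  (2 * n ^+ 2 - d ^+ 3 * (u * n + 2 * u ^+ 2)) / (2 * u ^+ 2 * n ^+ 2).
  by rewrite /d; field; rewrite une nne.
apply: divr_ge0; last by rewrite -mulrA -exprMn mulr_ge0 ?sqr_ge0.
(* From u <= 2n, u n + 2u^2 <= 10 n^2; times 1/8 this stays below 2 n^2. *)
have d3 : d ^+ 3 <= 1 / 8.
  have -> : 1 / 8 = (1 / 2) ^+ 3 :> R by field.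
  by rewrite lerXn2r ?nnegrE//; lra.
have q0 : 0 <= u * n + 2 * u ^+ 2 by rewrite addr_ge0 ?mulr_ge0 ?sqr_ge0// ltW.
have := ler_wpM2r q0 d3.
nra.
Qed.

(** * Explicit error bound and the asymptotics *)

Lemma F0_error (R : realType) (x : R) : expR 1 <= x ->
  `|F0 x - (expR 1 * ln x + expR 1 / 2 * (dist_int (ln x) ^+ 2 / ln x))|
    <= expR 1 * (1 / ln x ^+ 2).
Proof.
move=> ex; have x0 : 0 < x by apply: lt_le_trans ex; exact: expR_gt0.
have u1 : 1 <= ln x by rewrite -[leLHS](expRK 1) ler_ln// posrE expR_gt0.
set u := ln x in u1 *; set E := expR 1.
have E0 : 0 < E by exact: expR_gt0.
have u0 : 0 < u by lra.
have [m [dE d12]] := dist_intP u.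
(* As u >= 1, the nearest integer is at least 1/2, hence positive and an admissible number of
   summands. *)
have [n n0 mn] : exists2 n : nat, (0 < n)%N & m = n.
  have : 0 < m by rewrite -(ltr0z R); move: d12; rewrite ler_norml => /andP[_]; lra.
  by case: m {dE d12} => // n n0; exists n.
have le_ub : F0 x <= E * (u + dist_int u ^+ 2 / u / 2 + 1 / u ^+ 2).
  apply: (le_trans (F0_le n0 x0)); rewrite -/u expR_div_shift ?pnatr_eq0 -?lt0n//.
  rewrite mulrCA ler_pM2l// dE mn; apply: scaled_exp_le => //.
  by rewrite mn in d12.
have ge_lb : E * (u + dist_int u ^+ 2 / u / 2 - 1 / u ^+ 2) <= F0 x.
  apply: F0_ge => // k k0.
  rewrite -/u expR_div_shift ?pnatr_eq0 -?lt0n// mulrCA ler_pM2l//.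
  apply: scaled_exp_ge; rewrite ?ltr0n//; last exact: (dist_int_le u k).
  by rewrite dE normr_ge0.
by rewrite ler_norml; apply/andP; split; lra.
Qed.

Theorem theorem2 (R : realType) : forall x : R,
  F0 x = expR 1 * ln x + expR 1 / 2 * (dist_int (ln x) ^+ 2 / ln x)
         +O_(x \near +oo) (1 / ln x ^+ 2).
Proof.
move=> x.
pose g (y : R) := expR 1 * ln y + expR 1 / 2 * (dist_int (ln y) ^+ 2 / ln y).
(* The Landau statement is the value at [x] of an identity of functions, which follows from an
   eventual bound. *)
have [_ H] := @eqaddOP R R R R (pinfty_filter_on R) (@F0 R) g
  (fun y => 1 / ln y ^+ 2).
suff /H F0E : \forall k \near +oo, \forall y \near +oo,
    `|(@F0 R - g) y| <= k * `|1 / ln y ^+ 2|.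
  exact: (congr1 (fun f => f x) F0E).
(* Any k >= e works, on the range y >= e. *)
near=> k; near=> y.
apply: (@le_trans _ _ (expR 1 * (1 / ln y ^+ 2))).
  by apply: F0_error; near: y; apply: nbhs_pinfty_ge; exact: num_real.
apply: ler_pM; rewrite ?expR_ge0 ?divr_ge0 ?sqr_ge0 ?ler_norm//.
Unshelve. all: by end_near.
Qed.
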